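(* Let $L$ be a Lie superalgebra with a direct sum decomposition $L=K\oplus V$ (as a $\mathbb{Z}_2$-graded vector space), where $K$ and $V$ are subalgebras and $V$ is Abelian, and let $P\colon L\to V$ be the projector onto $V$ parallel to $K$. Let $D\colon L\to L$ be an odd derivation such that $D(K)\subset K$, where $K=\operatorname{Ker}P$. Then for all $n=1,2,3,\ldots$ and all $a_1,\ldots,a_n\in V$, the $n$-th Jacobiator $J^n_D$ of the higher derived brackets of $D$ equals the $n$-th higher derived bracket of the (even) derivation $D^2$: $$J^n_D(a_1,\ldots,a_n)=\{a_1,\ldots,a_n\}_{D^2}.$$
   Context: Vector spaces are $\mathbb{Z}_2$-graded over a fixed field of characteristic zero; the parity of a homogeneous $a$ is $\tilde a\in\{0,1\}$; symmetry, derivations, Lie brackets, etc. are understood in the $\mathbb{Z}_2$-graded (super) sense. For a derivation $D\colon L\to L$ (even or odd), the $k$-th higher derived bracket of $D$, $k=1,2,3,\ldots$, is the multilinear operation on $V$ $$\{a_1,\ldots,a_k\}_D:=P[\ldots[[Da_1,a_2],a_3],\ldots,a_k],\qquad a_i\in V$$ (for $k=1$: $\{a\}_D=PDa$). Since $V$ is Abelian these operations are symmetric. The $0$-ary bracket is set to be zero. For a sequence of odd symmetric $k$-linear operations $\{\ ,\ldots,\ \}$ on $V$, $k=0,1,2,\ldots$, the $n$-th Jacobiator is $$J^n(a_1,\ldots,a_n)=\sum_{k+l=n}\ \sum_{(k,l)\text{-shuffles }\sigma}(-1)^{\varepsilon}\{\{a_{\sigma(1)},\ldots,a_{\sigma(k)}\},a_{\sigma(k+1)},\ldots,a_{\sigma(k+l)}\},$$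 for homogeneous $a_i$, where $k,l\ge 0$ and $(-1)^{\varepsilon}$ is the usual sign of the permutation $a_1,\ldots,a_n\mapsto a_{\sigma(1)},\ldots,a_{\sigma(n)}$ of graded-commuting homogeneous elements (a factor $(-1)^{\tilde a\tilde b}$ for each interchange of $a$ and $b$). $J^n_D$ denotes the $n$-th Jacobiator of the higher derived brackets of $D$. *)

(* Defs.v *)
From HB Require Import structures.
From mathcomp Require Import all_boot all_order all_fingroup all_algebra.

Set Implicit Arguments.
Unset Strict Implicit.
Unset Printing Implicit Defensive.

Import GRing.Theory.
Local Open Scope ring_scope.

(* Parities are booleans (false = even, true = odd), added with (+).  A grading
   L = L_0 (+) L_1 is given by its two component maps; L_p is the image of
   gcomp p, i.e. the set of its fixed points. *)
HB.mixin Record Lmodule_isSuperspace (F : fieldType) L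
    of GRing.Lmodule F L := {
  gcomp : bool -> L -> L;
  gcomp_linear : forall p, linear (gcomp p);
  gcomp_proj : forall p q x, gcomp p (gcomp q x) = if p == q then gcomp q x else 0;
  gcomp_sum : forall x, gcomp false x + gcomp true x = x
}.

#[short(type="superspaceType")]
HB.structure Definition Superspace (F : fieldType) :=
  {L of Lmodule_isSuperspace F L & GRing.Lmodule F L}.

Definition homogeneous (F : fieldType) (L : superspaceType F) (p : bool)
  (x : L) : Prop := gcomp p x = x.

HB.mixin Record Superspace_isLieSuperalg (F : fieldType) L
    of Superspace F L := {
  lie : L -> L -> L;
  lie_linear_l : forall y, linear (lie^~ y);
  lie_linear_r : forall x, linear (lie x);
  lie_homogeneous : forall p q (x y : L), homogeneous p x -> homogeneous q y ->
    homogeneous (p (+) q) (lie x y);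
  lie_antisym : forall p q (x y : L), homogeneous p x -> homogeneous q y ->
    lie x y = - ((-1) ^+ (p && q) *: lie y x);
  lie_jacobi : forall p q r (x y z : L),
    homogeneous p x -> homogeneous q y -> homogeneous r z ->
    lie x (lie y z) = lie (lie x y) z + (-1) ^+ (p && q) *: lie y (lie x z)
}.

#[short(type="lieSuperalgType")]
HB.structure Definition LieSuperalg (F : fieldType) :=
  {L of Superspace_isLieSuperalg F L & Superspace F L}.

Section Subspaces.
Variables (F : fieldType) (L : lieSuperalgType F).
Implicit Types (A B : L -> Prop).

Record graded_subspace A : Prop := GradedSubspace {
  gsub_0 : A 0;
  gsub_lin : forall (c : F) x y, A x -> A y -> A (c *: x + y);
  gsub_comp : forall p x, A x -> A (gcomp p x)
}.

Definition subalgebra A : Prop :=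
  graded_subspace A /\ (forall x y, A x -> A y -> A (lie x y)).

Definition abelian_subset A : Prop := forall x y, A x -> A y -> lie x y = 0.

Definition is_direct_sum A B : Prop :=
  (forall x, exists y z, [/\ A y, B z & x = y + z]) /\
  (forall x, A x -> B x -> x = 0).

(* When L = K (+) V this determines P x as the V-component of x. *)
Definition is_projector (V K : L -> Prop) (P : L -> L) : Prop :=
  forall x, V (P x) /\ K (x - P x).

Record derivation (q : bool) (D : L -> L) : Prop := Derivation {
  der_linear : linear D;
  der_homogeneous : forall p x, homogeneous p x -> homogeneous (q (+) p) (D x);
  der_leibniz : forall p x y, homogeneous p x ->
    D (lie x y) = lie (D x) y + (-1) ^+ (q && p) *: lie x (D y)
}.

End Subspaces.

(* The operations of all arities on V are packed as one function on lists of
   elements of L; only its values on lists of elements of V matter. *)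
Definition higher_derived_bracket (F : fieldType) (L : lieSuperalgType F)
    (P D : L -> L) (s : seq L) : L :=
  if s is a :: s' then P (foldl lie (D a) s') else 0.

Section Jacobiator.
Variables (F : fieldType) (L : superspaceType F).

Definition is_shuffle n (k : nat) (s : 'S_n) : bool :=
  [forall i : 'I_n, forall j : 'I_n,
    ((i < j) && ((i < k) == (j < k)))%N ==> (s i < s j)%N].

(* Number of inversions of s between odd elements; its parity is the exponent
   of the sign of a_1, ..., a_n |-> a_(s 1), ..., a_(s n) when a_i has parity
   p i. *)
Definition koszul_exponent n (p : 'I_n -> bool) (s : 'S_n) : nat :=
  (\sum_(i < n) \sum_(j < n | (i < j) && (s j < s i)) (p (s i) && p (s j)))%N.

Definition jacobiator_homogeneous (op : seq L -> L) n (p : 'I_n -> bool)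
    (a : n.-tuple L) : L :=
  \sum_(k < n.+1) \sum_(s : 'S_n | is_shuffle k s)
    let b := [seq tnth a (s i) | i <- enum 'I_n] in
    (-1) ^+ koszul_exponent p s *: op (op (take k b) :: drop k b).

(* The multilinear extension of the formula for homogeneous arguments to
   arbitrary ones; see jacobiatorE. *)
Definition jacobiator (op : seq L -> L) n (a : n.-tuple L) : L :=
  \sum_(p : {ffun 'I_n -> bool})
    jacobiator_homogeneous op p [tuple gcomp (p i) (tnth a i) | i < n].

Lemma jacobiatorE (op : seq L -> L) n (p : 'I_n -> bool) (a : n.-tuple L) :
  (forall s, 0 \in s -> op s = 0) ->
  (forall i, homogeneous (p i) (tnth a i)) ->
  jacobiator op a = jacobiator_homogeneous op p a.
Proof.
move=> op0 ha; rewrite /jacobiator (bigD1 (finfun p)) //= big1 ?addr0.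
  rewrite /jacobiator_homogeneous; apply: eq_bigr => k _.
  apply: eq_bigr => s _; congr (_ ^+ _ *: _).
    apply: eq_bigr => i _; apply: eq_bigr => j _.
    by rewrite !ffunE.
  by under eq_map => i do rewrite tnth_mktuple ffunE ha.
move=> q neq_qp.
have [i qi]: exists i, q i != p i.
  apply/existsP; apply: contraNT neq_qp => /existsPn h.
  by apply/eqP/ffunP => i; rewrite ffunE; apply/eqP; rewrite -[_ == _]negbK h.
apply: big1 => k _; apply: big1 => s _ /=.
set b := map _ _.
have b0 : 0 \in b.
  apply/mapP; exists ((s^-1)%g i); first by rewrite mem_enum.
  by rewrite permKV tnth_mktuple -(ha i) gcomp_proj (negPf qi).
rewrite [op (_ :: _)]op0 ?scaler0 //.
move: b0; rewrite -{1}(cat_take_drop k b) mem_cat inE.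
case/orP => [/op0 -> | ->]; by rewrite ?eqxx ?orbT.
Qed.

End Jacobiator.

(* Main.v *)
(* For x homogeneous and l a list of elements of V, write [x, l] for the iterated
   bracket of x with l.  The Leibniz rule gives
     D [x, l] = [D x, l] + sum +- [[x, A], [D b, B]]
   over the unshuffles of l into A and b :: B.  Take x = D a and apply P.  On the
   left, P D = P D P since D preserves K = Ker P.  On the right,
   P [x, y] = P [P x, y] + P [x, P y] since K is a subalgebra and V is Abelian;
   the two halves of the sum are the terms {{a, A}, b, B} and {{b, B}, a, A} of
   the Jacobiator of a :: l, according to whether a lies in the inner bracket. *)
Require Import Defs.
From HB Require Import structures.
From mathcomp Require Import all_boot all_order all_fingroup all_algebra.
Import GRing.Theory.
Local Open Scope ring_scope.

Set Implicit Arguments.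
Unset Strict Implicit.
Unset Printing Implicit Defensive.

(** * Signed sums over the unshuffles of a list into two blocks *)

Section UnshuffleSum.
Variables (R : comPzRingType) (M : lmodType R) (T : Type) (par : T -> bool).
Implicit Types (f g : seq T -> seq T -> M) (l A B : seq T).

Definition parity_seq l : bool := foldr (fun t => addb (par t)) false l.

(* The sign arises because an element sent to B moves past all the elements of A
   that followed it. *)
Fixpoint unshuffle_sum l f : M :=
  if l is t :: l' then
    unshuffle_sum l' (fun A B => f (t :: A) B) +
    unshuffle_sum l'
      (fun A B => (-1) ^+ (par t && parity_seq A) *: f A (t :: B))
  else f [::] [::].

Lemma eq_unshuffle_sum f g l :
  (forall A B, f A B = g A B) -> unshuffle_sum l f = unshuffle_sum l g.
Proof.
elim: l f g => [|t l IHl] f g fg //=.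
by congr (_ + _); apply: IHl => A B; rewrite fg.
Qed.

Lemma unshuffle_sumD f g l :
  unshuffle_sum l (fun A B => f A B + g A B) =
  unshuffle_sum l f + unshuffle_sum l g.
Proof.
elim: l f g => [|t l IHl] f g //=.
rewrite IHl addrACA; congr (_ + _).
by rewrite -IHl; apply: eq_unshuffle_sum => A B; rewrite scalerDr.
Qed.

Lemma unshuffle_sumZ (c : R) f l :
  unshuffle_sum l (fun A B => c *: f A B) = c *: unshuffle_sum l f.
Proof.
elim: l f => [|t l IHl] f //=.
rewrite scalerDr IHl; congr (_ + _).
by rewrite -IHl; apply: eq_unshuffle_sum => A B; rewrite !scalerA mulrC.
Qed.

Lemma unshuffle_sum0 l : unshuffle_sum l (fun _ _ => 0) = 0.
Proof.
elim: l => //= t l IHl.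
rewrite IHl add0r -[RHS]IHl; apply: eq_unshuffle_sum => A B.
by rewrite scaler0.
Qed.

(** A letter sent to [B] kills its term, so only the unshuffle with [A = l] survives, with sign
    1. *)
Lemma unshuffle_sum_nilr (g : seq T -> M) l :
  unshuffle_sum l (fun A B => if B is [::] then g A else 0) = g l.
Proof.
elim: l g => //= t l IHl g.
rewrite (IHl (g \o cons t)) -[RHS]addr0; congr (_ + _).
rewrite -[RHS](unshuffle_sum0 l); apply: eq_unshuffle_sum => A B.
by rewrite scaler0.
Qed.

(** Exchanging the blocks permutes the unshuffles; the sign is that of moving all of [A] past all of
    [B]. *)
Lemma unshuffle_sum_swap f l :
  unshuffle_sum l f =
  unshuffle_sum l
    (fun A B => (-1) ^+ (parity_seq A && parity_seq B) *: f B A).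
Proof.
elim: l f => [|t l IHl] f /=; first by rewrite scale1r.
rewrite addrC; congr (_ + _).
  rewrite IHl; apply: eq_unshuffle_sum => A B /=.
  rewrite scalerA -signr_addb; congr (_ ^+ _ *: _).
  by case: (par t) (parity_seq A) (parity_seq B) => [] [] [].
rewrite IHl; apply: eq_unshuffle_sum => A B /=.
rewrite scalerA -signr_addb; congr (_ ^+ _ *: _).
by case: (par t) (parity_seq A) (parity_seq B) => [] [] [].
Qed.

End UnshuffleSum.

Lemma raddf_unshuffle_sum (R : comPzRingType) (M N : lmodType R)
    (phi : {linear M -> N}) (T : Type) (par : T -> bool) f (l : seq T) :
  phi (unshuffle_sum par l f) = unshuffle_sum par l (fun A B => phi (f A B)).
Proof.
elim: l f => //= t l IHl f.
rewrite linearD !IHl; congr (_ + _).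
by apply: eq_unshuffle_sum => A B; rewrite linearZ.
Qed.

(** * Shuffle permutations, encoded by the subset filling the first block *)

Section ShufflesAndSubsets.
Variable n : nat.
Implicit Types (s : 'S_n) (A : {set 'I_n}) (r : seq 'I_n).

Lemma big_subset_cons (M : nmodType) i r (F : {set 'I_n} -> M) :
  i \notin r ->
  \sum_(A : {set 'I_n} | A \subset i :: r) F A =
  \sum_(A : {set 'I_n} | A \subset r) F (i |: A) +
  \sum_(A : {set 'I_n} | A \subset r) F A.
Proof.
move=> ir; rewrite (bigID (fun A : {set 'I_n} => i \in A)) /=; congr (_ + _).
  rewrite (reindex_onto (fun A => i |: A) (fun A => A :\ i)) /=; last first.
    by move=> A /andP[_ iA]; rewrite setD1K.
  apply: eq_bigl => A; rewrite setU11 andbT.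
  apply/andP/subsetP => [[/subsetP sA /eqP eA] j jA|sA].
    move: (sA j); rewrite !inE jA orbT => /(_ isT)/predU1P[ji|//].
    by move: jA; rewrite -eA ji setD11.
  split; last by rewrite setU1K //; apply: contra ir => /sA.
  apply/subsetP => j /setU1P[->|/sA]; rewrite !inE ?eqxx // => ->.
  by rewrite orbT.
apply: eq_bigl => A; apply/andP/subsetP => [[/subsetP sA iA] j jA|sA].
  by move: (sA _ jA); rewrite inE => /predU1P[ji|//]; rewrite -ji jA in iA.
split; last by apply: contra ir => /sA.
by apply/subsetP => j /sA jr; rewrite inE jr orbT.
Qed.

(** The Koszul exponent of a shuffle, expressed through the values in its first block [A] alone. *)
Definition inversion_count (p : 'I_n -> bool) r (A : {set 'I_n}) : nat :=
  (\sum_(v <- r | v \notin A)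
    \sum_(u <- r | (u \in A) && (v < u)) (p u && p v))%N.

Lemma odd_sum_parity p r (P : pred 'I_n) (b : bool) :
  odd (\sum_(u <- r | P u) (p u && b))%N =
  b && parity_seq p [seq u <- r | P u].
Proof.
elim: r => [|u r IHr]; first by rewrite big_nil andbF.
rewrite big_cons /=; case: (P u) => //=.
rewrite oddD oddb {}IHr.
by case: b (p u) => [] [].
Qed.

(** The head [i] of [r] is its least element: put in [A] it creates no inversion, left out of [A] it
    is inverted with every element of [A]. These are the two branches of [unshuffle_sum]. *)
Lemma subset_sum_unshuffle (R : comPzRingType) (M : lmodType R)
    (p : 'I_n -> bool) (f : seq 'I_n -> seq 'I_n -> M) r :
  sorted (fun i j : 'I_n => i < j)%N r ->
  \sum_(A : {set 'I_n} | A \subset r) (-1) ^+ inversion_count p r A *: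
    f [seq i <- r | i \in A] [seq i <- r | i \notin A] =
  unshuffle_sum p r f.
Proof.
elim: r f => [|i r IHr] f sr.
  rewrite (big_pred1 set0) /=; first by rewrite /inversion_count big_nil scale1r.
  move=> A; apply/idP/eqP => [/subsetP sA|->]; last by apply/subsetP => j; rewrite inE.
  by apply/setP => j; rewrite inE; apply/negP => /sA.
have ltr : {in r, forall j : 'I_n, (i < j)%N}.
  by move: sr => /= /(order_path_min (fun _ _ _ => @ltn_trans _ _ _))/allP.
have ir : i \notin r by apply/negP => /ltr; rewrite ltnn.
rewrite big_subset_cons //= -!IHr ?(path_sorted sr) //.
congr (_ + _); apply: eq_bigr => A /subsetP sA.
  rewrite setU11 /=; congr (_ ^+ _ *: f (_ :: _) _).
  - rewrite /inversion_count big_cons setU11 /=.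
    rewrite big_seq_cond [RHS]big_seq_cond.
    apply: eq_big => [v|v /andP[vr _]].
      case vr: (v \in r) => //=; rewrite !inE.
      by case: eqP => // vi; rewrite -vi vr in ir.
    rewrite big_cons setU11 ltnNge (ltnW (ltr _ vr)) /=.
    rewrite big_seq_cond [RHS]big_seq_cond.
    apply: eq_bigl => u; case ur: (u \in r) => //=; rewrite !inE.
    by case: eqP => // ui; rewrite -ui ur in ir.
  - apply: eq_in_filter => u ur; rewrite !inE.
    by case: eqP => // ui; rewrite -ui ur in ir.
  - apply: eq_in_filter => u ur; rewrite !inE.
    by case: eqP => // ui; rewrite -ui ur in ir.
have iA : i \notin A by apply: contra ir => /sA.
rewrite (negPf iA) /= scalerA; congr (_ *: _).
rewrite -signr_odd -[in RHS]signr_odd -signr_addb; congr (_ ^+ _).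
rewrite /inversion_count big_cons iA oddD big_cons (negPf iA) /=.
rewrite addbC; congr (_ (+) _).
  congr odd; rewrite big_seq_cond [RHS]big_seq_cond.
  by apply: eq_bigr => v _; rewrite big_cons (negPf iA).
rewrite odd_sum_parity; congr (_ && parity_seq _ _).
by apply: eq_in_filter => u ur; rewrite ltr ?andbT.
Qed.

Lemma sorted_enum_ord : sorted (fun i j : 'I_n => i < j)%N (enum 'I_n).
Proof.
by have := iota_ltn_sorted 0 n; rewrite -val_enum_ord sorted_map.
Qed.

Lemma sorted_enum_pred (C : {pred 'I_n}) :
  sorted (fun i j : 'I_n => i < j)%N (enum C).
Proof.
rewrite /enum_mem sorted_filter -?enumT ?sorted_enum_ord // => ? ? ?.
exact: ltn_trans.
Qed.

(** The image under [s] of the first [k] positions; together with [k] it determines a shuffle. *)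
Definition first_block (k : nat) s : {set 'I_n} :=
  [set u | ((s^-1)%g u < k)%N].

(** A shuffle increases on each block, and two strictly increasing lists with the same elements
    coincide. *)
Lemma map_shuffle k s : (k <= n)%N -> is_shuffle k s ->
  [/\ k = #|first_block k s|,
      take k [seq s i | i <- enum 'I_n] = enum (first_block k s) &
      drop k [seq s i | i <- enum 'I_n] = enum (~: first_block k s)].
Proof.
move=> kn /forallP sh.
have tr : transitive (fun i j : 'I_n => i < j)%N by move=> ? ? ?; apply: ltn_trans.
have irr : irreflexive (fun i j : 'I_n => i < j)%N by move=> i; apply: ltnn.
have ltk : forall i : 'I_n, ((i : nat) \in take k (iota 0 n)) = (i < k)%N.
  by move=> i; rewrite take_iota mem_iota /= add0n leq_min ltn_ord andbT.
have gek : forall i : 'I_n, ((i : nat) \in drop k (iota 0 n)) = (k <= i)%N.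
  by move=> i; rewrite drop_iota mem_iota add0n subnKC // ltn_ord andbT.
have E1 : take k [seq s i | i <- enum 'I_n] = enum (first_block k s).
  apply: (irr_sorted_eq tr irr).
  - rewrite -map_take sorted_map.
    have := take_sorted k sorted_enum_ord.
    apply: (sub_in_sorted (P := fun i : 'I_n => i < k)%N).
      move=> i j; rewrite !unfold_in => ik jk ij.
      by move: (sh i) => /forallP/(_ j)/implyP; apply; rewrite ij ik jk.
    apply/allP => i; rewrite -(mem_map val_inj) map_take val_enum_ord ltk.
    by [].
  - exact: sorted_enum_pred.
  - move=> u; rewrite mem_enum inE -map_take.
    rewrite -[u in LHS](permKV s) (mem_map perm_inj).
    by rewrite -(mem_map val_inj) map_take val_enum_ord ltk.
split=> //; last first.
  apply: (irr_sorted_eq tr irr).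
  - rewrite -map_drop sorted_map.
    have := drop_sorted k sorted_enum_ord.
    apply: (sub_in_sorted (P := fun i : 'I_n => k <= i)%N).
      move=> i j; rewrite !unfold_in => ik jk ij.
      move: (sh i) => /forallP/(_ j)/implyP; apply.
      by rewrite ij !ltnNge ik jk.
    apply/allP => i; rewrite -(mem_map val_inj) map_drop val_enum_ord gek.
    by [].
  - exact: sorted_enum_pred.
  - move=> u; rewrite mem_enum !inE -map_drop -leqNgt.
    rewrite -[u in LHS](permKV s) (mem_map perm_inj).
    by rewrite -(mem_map val_inj) map_drop val_enum_ord gek.
by rewrite cardE -E1 size_takel // size_map size_enum_ord.
Qed.

Lemma shuffle_exists A :
  exists2 s, is_shuffle #|A| s & first_block #|A| s = A.
Proof.
(* The shuffle lists [A] increasingly, then its complement increasingly. *)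
pose r := enum A ++ enum (~: A).
have sz : size r = n by rewrite size_cat -!cardE cardsC card_ord.
have ur : uniq r.
  rewrite cat_uniq !enum_uniq andbT; apply/hasPn => i.
  by rewrite !mem_enum inE.
(* The index [i] serves as the default of [nth]; it is never returned, since [r] has length [n]. *)
have inj : injective (fun i : 'I_n => nth i r i).
  move=> i j; rewrite (set_nth_default j) ?sz // => /eqP.
  by rewrite nth_uniq ?sz // => /eqP/val_inj.
pose s := perm inj.
have sE (i i0 : 'I_n) : s i = nth i0 r i.
  by rewrite permE (set_nth_default i0) ?sz.
have lt_sorted (C : {pred 'I_n}) i0 i j : (i < j < size (enum C))%N ->
    (nth i0 (enum C) i < nth i0 (enum C) j)%N.
  move=> /andP[ij jC].
  apply: (sorted_ltn_nth (leT := fun i j : 'I_n => i < j)%N) => //.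
  - by move=> ? ? ?; apply: ltn_trans.
  - exact: sorted_enum_pred.
  - exact: ltn_trans jC.
exists s.
  apply/forallP => i; apply/forallP => j; apply/implyP => /andP[ij /eqP e].
  rewrite !(sE _ i) !nth_cat -!cardE -e; case: ifP => ik.
    by apply: lt_sorted; rewrite ij -cardE -e ik.
  move/negbT: ik; rewrite -leqNgt => ki.
  apply: lt_sorted; rewrite ltn_sub2r ?(leq_ltn_trans ki) //= -cardE.
  by rewrite ltn_subLR ?(leq_trans ki (ltnW ij)) // cardsC card_ord.
apply/setP => u; rewrite inE; set i := (s^-1)%g u.
have -> : u = s i by rewrite permKV.
rewrite (sE _ i) nth_cat -cardE; case: ifP => ik.
  by apply/esym; rewrite -mem_enum mem_nth // -cardE.
apply/esym/negbTE; rewrite -in_setC -mem_enum mem_nth // -cardE.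
have ki : (#|A| <= i)%N by rewrite leqNgt ik.
by rewrite ltn_subLR // cardsC card_ord.
Qed.

Lemma koszul_exponent_inversions p k s : is_shuffle k s ->
  koszul_exponent p s = inversion_count p (enum 'I_n) (first_block k s).
Proof.
move=> /forallP sh; rewrite /koszul_exponent /inversion_count.
(* The outer index becomes the later position [j], whose value [s j] is the smaller one, the [v] of
   [inversion_count]. *)
rewrite (exchange_big_dep predT) //= big_enum_cond /=.
rewrite [RHS]big_mkcond [RHS](reindex_inj (@perm_inj _ s)) /=.
apply: eq_bigr => j _; rewrite inE permK -leqNgt.
rewrite [in RHS]big_enum_cond /= [in RHS](reindex_inj (@perm_inj _ s)) /=.
(* An inverted pair cannot lie inside one block, where [s] increases. *)
have ltP (i : 'I_n) : (i < j)%N -> (s j < s i)%N -> (i < k)%N /\ (k <= j)%N.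
  move=> ij ji; move: (sh i) => /forallP/(_ j); rewrite ij /= [(s i < _)%N]ltnNge (ltnW ji).
  rewrite implybF; case: (ltnP i k) (ltnP j k) => [ik|ki] [jk|kj] //.
  by move: (leq_ltn_trans ki (ltn_trans ij jk)); rewrite ltnn.
case: ifP => kj.
  apply: eq_bigl => i; rewrite inE permK.
  case ji: (s j < s i)%N; rewrite ?andbF ?andbT //.
  apply/idP/idP => [/ltP/(_ ji)[]//|ik]; exact: leq_trans ik kj.
by apply: big_pred0 => i; apply/andP => -[/ltP h /h[_]]; rewrite kj.
Qed.

Lemma shuffle_sum_unshuffle (R : comPzRingType) (M : lmodType R)
    (p : 'I_n -> bool) (f : seq 'I_n -> seq 'I_n -> M) :
  \sum_(k < n.+1) \sum_(s : 'S_n | is_shuffle k s)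
    (let b := [seq s i | i <- enum 'I_n] in
     (-1) ^+ koszul_exponent p s *: f (take k b) (drop k b)) =
  unshuffle_sum p (enum 'I_n) f.
Proof.
rewrite pair_big_dep /= -subset_sum_unshuffle ?sorted_enum_ord //.
(* Group the pairs [(k, s)] by first block: each subset [A] comes from exactly one pair, with
   [k = #|A|]. *)
rewrite (partition_big (fun ks : 'I_n.+1 * 'S_n => first_block ks.1 ks.2) predT) //=.
rewrite [RHS](eq_bigl predT) => [|A]; last first.
  by apply/subsetP => i; rewrite mem_enum.
apply: eq_bigr => A _; have [s sh sA] := shuffle_exists A.
have cA : (#|A| < n.+1)%N by rewrite ltnS -[n in leqRHS]card_ord max_card.
rewrite (big_pred1 (Ordinal cA, s)) /= => [|[k t] /=].
  have [_ -> ->] := map_shuffle (k := #|A|) cA sh.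
  rewrite sA (koszul_exponent_inversions _ sh) sA.
  congr (_ *: f _ _); rewrite {1}/enum_mem -enumT; apply: eq_filter => i //.
  by rewrite unfold_in /= inE.
apply/andP/eqP => [[sht /eqP tA]|[-> ->]]; last by rewrite sA.
have [ck tk dk] := map_shuffle (leq_ord k) sht.
have [_ sk ek] := map_shuffle (k := #|A|) cA sh.
have kA : k = Ordinal cA by apply: val_inj; rewrite /= ck tA.
rewrite kA; congr (_, _); apply/permP => i.
have: [seq t i | i <- enum 'I_n] = [seq s i | i <- enum 'I_n].
  by rewrite -[LHS](cat_take_drop k) tk dk tA -[RHS](cat_take_drop #|A|) sk ek sA.
by move/eq_in_map; apply; rewrite mem_enum.
Qed.

End ShufflesAndSubsets.

(** * Expansion of iterated brackets into homogeneous components *)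

Lemma sum_ffun_ord_recl (M : nmodType) n (G : {ffun 'I_n.+1 -> bool} -> M) :
  \sum_p G p = \sum_(b : bool) \sum_(q : {ffun 'I_n -> bool})
    G [ffun i => oapp q b (unlift ord0 i)].
Proof.
rewrite pair_big /=.
rewrite (reindex (fun bq : bool * {ffun 'I_n -> bool} =>
    [ffun i => oapp bq.2 bq.1 (unlift ord0 i)])) //=.
apply: onW_bij; exists (fun p : {ffun 'I_n.+1 -> bool} =>
  (p ord0, [ffun i : 'I_n => p (lift ord0 i)])).
  case=> b q; rewrite ffunE unlift_none; congr (_, _).
  by apply/ffunP => i; rewrite !ffunE liftK.
move=> p; apply/ffunP => i; rewrite ffunE.
by case: unliftP => [j ->|->] //=; rewrite ffunE.
Qed.

Section LieLinear.
Variables (F : fieldType) (L : lieSuperalgType F).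

HB.instance Definition _ (x : L) :=
  GRing.isLinear.Build F L L *:%R (lie x) (lie_linear_r x).

(** A name for the right bracket, so that it can carry a linear structure. *)
Definition lier (y x : L) : L := lie x y.

HB.instance Definition _ (y : L) :=
  GRing.isLinear.Build F L L *:%R (lier y) (lie_linear_l y).

HB.instance Definition _ p :=
  GRing.isLinear.Build F L L *:%R (@gcomp F L p) (gcomp_linear p).

Definition iter_lie (l : seq L) (x : L) : L := foldl lie x l.

Lemma iter_lie_linear l : linear (iter_lie l).
Proof.
move=> c x y; rewrite /iter_lie; elim: l x y => //= a l IHl x y.
by rewrite -IHl -!/(lier a _) linearP.
Qed.

HB.instance Definition _ l :=
  GRing.isLinear.Build F L L *:%R (iter_lie l) (iter_lie_linear l).

Lemma iter_lie_gcomp n (f : 'I_n -> L) x :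
  iter_lie [seq f i | i <- enum 'I_n] x =
  \sum_(p : {ffun 'I_n -> bool})
    iter_lie [seq gcomp (p i) (f i) | i <- enum 'I_n] x.
Proof.
elim: n f x => [|n IHn] f x.
  rewrite (big_pred1 [ffun=> false]) => [|p]; last first.
    by apply/esym/eqP/ffunP => -[].
  by rewrite !(size0nil (size_enum_ord 0)).
rewrite sum_ffun_ord_recl enum_ordSl /= -map_comp [LHS]IHn exchange_big /=.
apply: eq_bigr => q _.
under [RHS]eq_bigr => b _ do rewrite -map_comp ffunE unlift_none.
(* [gcomp_sum] puts the even component first, [big_bool] the odd one; hence [addrC]. *)
rewrite -[f ord0 in LHS]gcomp_sum linearD /= addrC big_bool /=.
by rewrite [iter_lie _ (_ + _)]linearD /=; congr (_ + _); congr foldl;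
  apply: eq_map => i /=; rewrite ffunE liftK.
Qed.

End LieLinear.

(** Matches the expansion by which [jacobiator] is defined, so that the theorem reduces to
    homogeneous arguments. *)
Lemma higher_derived_bracket_gcomp (F : fieldType) (L : lieSuperalgType F)
    (P D : {linear L -> L}) n (f : 'I_n -> L) :
  higher_derived_bracket P D [seq f i | i <- enum 'I_n] =
  \sum_(p : {ffun 'I_n -> bool})
    higher_derived_bracket P D [seq gcomp (p i) (f i) | i <- enum 'I_n].
Proof.
case: n f => [|n] f.
  by rewrite big1 => [|p _]; rewrite (size0nil (size_enum_ord 0)).
rewrite sum_ffun_ord_recl enum_ordSl /= -map_comp -/(iter_lie _ _).
rewrite (iter_lie_gcomp (f \o lift ord0)) linear_sum exchange_big /=.
apply: eq_bigr => q _.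
under [RHS]eq_bigr => b _ do rewrite -map_comp ffunE unlift_none.
rewrite -[f ord0 in LHS]gcomp_sum linearD /= addrC big_bool /=.
rewrite [iter_lie _ (_ + _)]linearD linearD /=.
by congr (_ + _); congr (P (foldl _ _ _));
  apply: eq_map => i /=; rewrite ffunE liftK.
Qed.

(** * The projector, and the Jacobiator of the higher derived brackets *)

Section HigherDerivedBrackets.
Variables (F : fieldType) (L : lieSuperalgType F).
Variables (K V : L -> Prop) (P D : L -> L).
Hypotheses (subK : subalgebra K) (subV : subalgebra V).
Hypotheses (abelV : abelian_subset V).
Hypotheses (KV : is_direct_sum K V) (projP : is_projector V K P).
Hypotheses (derD : derivation true D) (DK : forall x : L, K x -> K (D x)).

(** The difference of the two sides lies in both [K] and [V]. Linearity and parity preservation of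
    [P] follow from this. *)
Lemma projector_unique k v : K k -> V v -> P (k + v) = v.
Proof.
move=> Kk Vv; have [VP KP] := projP (k + v).
have [[gK _] [gV _]] := (subK, subV).
apply/eqP; rewrite -subr_eq0; apply/eqP; apply: KV.2.
  have := gsub_lin gK (-1) KP Kk.
  by rewrite scaleN1r opprB [X in _ - X]addrC opprD addrA subrK.
by have := gsub_lin gV (-1) Vv VP; rewrite scaleN1r addrC.
Qed.

Lemma projector_ker k : K k -> P k = 0.
Proof.
by move=> Kk; rewrite -[k]addr0 projector_unique //; case: subV => -[].
Qed.

Lemma projector_linear : linear P.
Proof.
move=> c x y; have [[gK _] [gV _]] := (subK, subV).
have [[VPx KPx] [VPy KPy]] := (projP x, projP y).
rewrite -[RHS](projector_unique
  (gsub_lin gK c KPx KPy) (gsub_lin gV c VPx VPy)).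
by rewrite addrACA -scalerDr !subrK.
Qed.

HB.instance Definition _ := GRing.isLinear.Build F L L *:%R P projector_linear.
HB.instance Definition _ := GRing.isLinear.Build F L L *:%R D (der_linear derD).

Lemma projector_homogeneous p x : homogeneous p x -> homogeneous p (P x).
Proof.
move=> hx; have [[gK _] [gV _]] := (subK, subV); have [VPx KPx] := projP x.
rewrite /homogeneous.
rewrite -(projector_unique (gsub_comp gK p KPx) (gsub_comp gV p VPx)).
by rewrite -linearD subrK /= hx.
Qed.

(** Expand [P (lie (x - P x) (y - P y)) = 0], where [lie (P x) (P y)] vanishes. *)
Lemma projector_lie x y : P (lie x y) = P (lie (P x) y) + P (lie x (P y)).
Proof.
have [[VPx KPx] [VPy KPy]] := (projP x, projP y).
have := projector_ker (subK.2 _ _ KPx KPy).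
have lieBl u v w : lie (u - v) w = lie u w - lie v w := linearB (lier w) u v.
have lieBr u v w : lie w (u - v) = lie w u - lie w v := linearB (lie w) u v.
rewrite lieBl !lieBr (abelV VPx VPy) subr0 -addrA -opprD.
rewrite linearB /= [P (_ + _)]linearD /=.
by move/eqP; rewrite subr_eq0 addrC => /eqP.
Qed.

Lemma projector_derivation x : P (D (P x)) = P (D x).
Proof.
have [VPx KPx] := projP x.
rewrite -[x in RHS](subrK (P x)) [D (_ + _)]linearD linearD /=.
by rewrite (projector_ker (DK KPx)) add0r.
Qed.

Variables (T : Type) (par : T -> bool) (a : T -> L).
Hypotheses (a_hom : forall t, homogeneous (par t) (a t)).
Hypotheses (aV : forall t, V (a t)).
Implicit Types (l A B : seq T) (x y z : L).

Local Notation pseq := (parity_seq par).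
Local Notation E l := (iter_lie (map a l)).

(** The higher derived bracket before [P] is applied; the value 0 on the empty list also makes later
    formulas uniform. *)
Definition derived l : L := if l is t :: l' then E l' (D (a t)) else 0.

Lemma iter_lie_homogeneous p x l :
  homogeneous p x -> homogeneous (p (+) pseq l) (E l x).
Proof.
elim: l p x => [|t l IHl] p x hx /=; first by rewrite addbF.
by rewrite addbA; apply/IHl/lie_homogeneous.
Qed.

(** The Jacobi identity as a Leibniz rule for bracketing with [z] on the right. *)
Lemma lie_lie_commutation p q r x y z :
  homogeneous p x -> homogeneous q y -> homogeneous r z ->
  lie (lie x y) z = lie x (lie y z) + (-1) ^+ (q && r) *: lie (lie x z) y.
Proof.
move=> hx hy hz; rewrite (lie_jacobi _ _ _ _ _ _ hx hy hz) -addrA.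
rewrite (lie_antisym _ _ _ _ hy (lie_homogeneous _ _ _ _ hx hz)) scalerN scalerA -signr_addb.
rewrite [X in - X](_ : _ = (-1) ^+ (q && r) *: lie (lie x z) y) ?addNr ?addr0 //.
by congr (_ ^+ _ *: _); case: p q r {hx hy hz} => [] [] [].
Qed.

(** Each letter acts as a derivation from the right, so it goes either to [x] or to [y]; the sign
    moves [y] past the letters sent to [x]. *)
Lemma iter_lie_lie p q x y l : homogeneous p x -> homogeneous q y ->
  E l (lie x y) = unshuffle_sum par l
    (fun A B => (-1) ^+ (q && pseq A) *: lie (E A x) (E B y)).
Proof.
elim: l p q x y => [|t l IHl] p q x y hx hy /=; first by rewrite andbF scale1r.
rewrite -[LHS]/(E l (lie (lie x y) (a t))).
rewrite (lie_lie_commutation hx hy (a_hom t)) linearD linearZ /= addrC.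
rewrite (IHl _ _ _ _ (lie_homogeneous _ _ _ _ hx (a_hom t)) hy).
rewrite (IHl _ _ _ _ hx (lie_homogeneous _ _ _ _ hy (a_hom t))).
rewrite -unshuffle_sumZ; congr (_ + _); apply: eq_unshuffle_sum => A B /=.
  rewrite scalerA -signr_addb; congr (_ ^+ _ *: _).
  by case: q (par t) (parity_seq _ _) {hy} => [] [] [].
rewrite scalerA -signr_addb; congr (_ ^+ _ *: _).
by case: q (par t) (parity_seq _ _) {hy} => [] [] [].
Qed.

Lemma derivation_iter_lie p x l : homogeneous p x ->
  D (E l x) = E l (D x) + unshuffle_sum par l
    (fun A B => (-1) ^+ (p (+) pseq A) *: lie (E A x) (derived B)).
Proof.
elim: l p x => [|t l IHl] p x hx /=; first by rewrite linear0 scaler0 addr0.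
rewrite (IHl _ _ (lie_homogeneous _ _ _ _ hx (a_hom t))).
(* The Leibniz term with [D (a t)] yields, after the remaining letters are distributed, the
   unshuffles whose second block starts with [t]. *)
rewrite (der_leibniz derD _ hx) linearD linearZ /= -!addrA; congr (_ + _).
rewrite addrC; congr (_ + _).
  by apply: eq_unshuffle_sum => A B; rewrite addbA.
rewrite (iter_lie_lie _ hx (der_homogeneous derD (a_hom t))) -unshuffle_sumZ.
apply: eq_unshuffle_sum => A B; rewrite !scalerA -!signr_addb.
congr (_ ^+ _ *: _).
by case: p (par t) (parity_seq _ _) {hx} => [] [] [].
Qed.

(** Apply [D] to [lie x y = 0]. *)
Lemma lie_derivation_commute p q x y : V x -> V y ->
  homogeneous p x -> homogeneous q y ->
  lie (D x) y = - ((-1) ^+ p *: lie x (D y)).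
Proof.
move=> Vx Vy hx hy; apply/eqP; rewrite -addr_eq0.
by rewrite -(der_leibniz derD _ hx) (abelV Vx Vy) linear0.
Qed.

(** All letters lie in [V] and commute with [x], so they act on [y] only. *)
Lemma iter_lie_abelian p q x y l : V x -> homogeneous p x -> homogeneous q y ->
  E l (lie x y) = lie x (E l y).
Proof.
move=> Vx hx; elim: l q y => //= t l IHl q y hy.
rewrite -[LHS]/(E l (lie (lie x y) (a t))).
rewrite (lie_lie_commutation hx hy (a_hom t)) (abelV Vx (aV t)).
rewrite -/(lier y 0) linear0 scaler0 addr0.
exact: (IHl _ _ (lie_homogeneous _ _ _ _ hy (a_hom t))).
Qed.

(** For [l] nonempty, [D] moves from [y] to the first letter and the other letters act on that
    factor. For [l] empty the last term is 0. *)
Lemma iter_lie_derivation p y l : V y -> homogeneous p y ->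
  P (E l (D y)) = (if l is [::] then P (D y) else 0)
    - (-1) ^+ p *: P (lie y (derived l)).
Proof.
move=> Vy hy; case: l => [|t l] /=; first by rewrite !linear0 addr0.
rewrite sub0r.
rewrite (lie_derivation_commute Vy (aV t) hy (a_hom t)) linearN linearZ /=.
rewrite (iter_lie_abelian _ Vy hy (der_homogeneous derD (a_hom t))).
by rewrite linearN linearZ.
Qed.

Definition bracket l : L := P (derived l).

Lemma jacobiator_unshuffle l :
  unshuffle_sum par l (fun A B => P (E B (D (bracket A)))) =
  if l is t :: l' then P (E l' (D (D (a t)))) else 0.
Proof.
case: l => [|t l] /=; first by rewrite /bracket /derived !linear0.
have hDa := der_homogeneous derD (a_hom t).
have VP x : V (P x) by case: (projP x).
have Vb A : V (bracket A) by exact: VP.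
have hE A : homogeneous (~~ par t (+) pseq A) (E A (D (a t))).
  exact: iter_lie_homogeneous hDa.
have hb A : homogeneous (~~ pseq A) (bracket A).
  (* The empty bracket is 0, which is homogeneous of either parity. *)
  apply: projector_homogeneous; case: A => [|u A] /=; first exact: linear0.
  by rewrite -addTb addbA; apply/iter_lie_homogeneous/der_homogeneous.
(* The sign of moving the odd [D] past [E A (D (a t))]. *)
pose c A := (-1) ^+ (~~ par t (+) pseq A) : F.
(* Terms with [t] in the inner bracket: empty [B] gives the term with [P (D _)], where
   [P D P = P D]; nonempty [B] gives the sum. *)
rewrite [X in X + _](_ : _ = P (D (E l (D (a t)))) - unshuffle_sum par l
    (fun A B => c A *: P (lie (P (E A (D (a t)))) (derived B)))); last first.
  rewrite -projector_derivation -scaleN1r -unshuffle_sumZ.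
  rewrite -[X in X + _](unshuffle_sum_nilr par
    (fun A => P (D (P (E A (D (a t))))))).
  rewrite -unshuffle_sumD; apply: eq_unshuffle_sum => A B.
  rewrite /bracket /=.
  rewrite (iter_lie_derivation _ (VP _) (projector_homogeneous (hE A))).
  by rewrite scaleN1r.
(* Terms with [t] outside the inner bracket: the blocks are swapped so that [A] again accompanies
   [t]. *)
rewrite [X in _ + X](_ : _ = - unshuffle_sum par l
    (fun A B => c A *: P (lie (E A (D (a t))) (bracket B)))); last first.
  rewrite -scaleN1r -unshuffle_sumZ unshuffle_sum_swap.
  apply: eq_unshuffle_sum => A B.
  rewrite (lie_derivation_commute (Vb _) (aV t) (hb B) (a_hom t)).
  rewrite linearN /= [E A (_ *: _)]linearZ /= (iter_lie_abelian _ (Vb _) (hb B) hDa).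
  rewrite (lie_antisym _ _ _ _ (hb B) (hE A)) scalerN opprK.
  rewrite [P (_ *: _)]linearZ /= [P (_ *: _)]linearZ /=.
  (* The scalar [-1] is read as a power of [-1], so that all signs merge into one boolean
     exponent. *)
  rewrite -[X in X *: (c A *: _)]/((-1) ^+ true) /c !scalerA -!signr_addb.
  congr (_ ^+ _ *: _).
  by case: (par t) (pseq A) (pseq B) => [] [] [].
(* By [projector_lie] the two sums add up to the correction term in [P (D (E l (D (a t))))], which
   leaves the bracket of [D] squared. *)
rewrite -addrA -opprD -unshuffle_sumD (derivation_iter_lie l hDa) linearD /=.
rewrite (raddf_unshuffle_sum [the {linear L -> L} of P]) /=.
rewrite -[RHS]addr0 -addrA; congr (_ + _).
apply/eqP; rewrite subr_eq0; apply/eqP; apply: eq_unshuffle_sum => A B.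
by rewrite linearZ /= projector_lie scalerDr.
Qed.

End HigherDerivedBrackets.

Theorem theorem1 (F : fieldType) (charF0 : [pchar F] =i pred0)
  (L : lieSuperalgType F) (K V : L -> Prop) (P D : L -> L)
  (subK : subalgebra K) (subV : subalgebra V) (abelV : abelian_subset V)
  (KV : is_direct_sum K V) (projP : is_projector V K P)
  (derD : derivation true D) (DK : forall x : L, K x -> K (D x))
  (n : nat) (n_gt0 : (0 < n)%N) (a : n.-tuple L)
  (aV : forall i : 'I_n, V (tnth a i)) :
  jacobiator (higher_derived_bracket P D) a =
  higher_derived_bracket P (D \o D) a.
Proof.
pose cD : {linear L -> L} :=
  HB.pack D (GRing.isLinear.Build F L L *:%R D (der_linear derD)).
pose cP : {linear L -> L} :=
  HB.pack P (GRing.isLinear.Build F L L *:%R P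
    (projector_linear subK subV KV projP)).
rewrite -(map_tnth_enum a).
rewrite (higher_derived_bracket_gcomp cP (cD \o cD) (tnth a)).
(* Both sides are now sums over parity assignments, compared term by term. *)
apply: eq_bigr => p _; rewrite /jacobiator_homogeneous.
pose f i := gcomp (p i) (tnth a i).
have f_hom i : homogeneous (p i) (f i) by rewrite /homogeneous gcomp_proj eqxx.
have fV i : V (f i) by apply: (gsub_comp subV.1).
(* The two differ in form on the empty list only, where [bracket] is [P 0]. *)
have hdbE (A : seq 'I_n) : higher_derived_bracket P D (map f A) =
    bracket P D f A.
  by case: A => //=; apply: esym (linear0 cP).
transitivity (unshuffle_sum p (enum 'I_n)
    (fun A B => P (iter_lie (map f B) (D (bracket P D f A))))).
  rewrite -shuffle_sum_unshuffle; apply: eq_bigr => k _; apply: eq_bigr => s _.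
  rewrite /= -hdbE !map_take !map_drop -map_comp.
  by under eq_map => i do rewrite tnth_mktuple.
rewrite (jacobiator_unshuffle subK subV abelV KV projP derD DK f_hom fV).
by case: (enum 'I_n).
Qed.
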